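(* Let $(H,\circ)$ be a hypersemigroup. Then $H$ is semisimple if and only if, for every fuzzy subset $f$ of $H$, we have $f\preceq 1\circ f\circ 1\circ f\circ 1$.
   Context: Let $\mathcal{P}^*(H)$ denote the set of nonempty subsets of $H$. A hypergroupoid is a nonempty set $H$ with a hyperoperation $\circ: H\times H\to \mathcal{P}^*(H)$, $(a,b)\mapsto a\circ b$; it induces an operation $*$ on $\mathcal{P}^*(H)$ by $A*B=\bigcup_{(a,b)\in A\times B}(a\circ b)$. A hypersemigroup is a hypergroupoid $H$ such that $(x\circ y)*\{z\}=\{x\}*(y\circ z)$ for all $x,y,z\in H$; in this case $*$ is associative on $\mathcal{P}^*(H)$, so iterated $*$-products are written without parentheses. A hypersemigroup $H$ is called semisimple if for every $a\in H$ there exist $x,y,z\in H$ such that $a\in (x\circ a)*(y\circ a)*\{z\}$. A fuzzy subset of $H$ is a mapping $f:H\to[0,1]$ into the real closed unit interval. For $a\in H$ put $A_a=\{(y,z)\in H\times H\mid a\in y\circ z\}$. For fuzzy subsets $f,g$ of $H$, the fuzzy subset $f\circ g$ of $H$ is defined by $(f\circ g)(a)=\sup_{(y,z)\in A_a}\min\{f(y),g(z)\}$ if $A_a\neq\emptyset$, and $(f\circ g)(a)=0$ if $A_a=\emptyset$. (The same symbol $\circ$ is used for the hyperoperation on $H$ and the product of fuzzy subsets.) When $H$ is a hypersemigroup this product of fuzzy subsets is associative, so iterated products are written without parentheses. The order on fuzzy subsets is $f\preceq g$ if and only if $f(x)\le g(x)$ for every $x\in H$. The symbol $1$ denotes the fuzzy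 subset of $H$ with $1(x)=1$ for every $x\in H$. *)

(* Defs.v *)
From mathcomp Require Import all_boot all_order all_algebra.
From mathcomp Require Import all_classical all_reals.
From mathcomp Require Export interval_inference.

Set Implicit Arguments.
Unset Strict Implicit.
Unset Printing Implicit Defensive.

Import Order.TTheory GRing.Theory Num.Theory.
Local Open Scope classical_set_scope.
Local Open Scope ring_scope.

Record hypergroupoid := Hypergroupoid {
  hcarrier :> Type;
  hcarrier_inhabited : inhabited hcarrier;
  hop : hcarrier -> hcarrier -> set hcarrier;
  hop_nonempty : forall x y, hop x y !=set0
}.

Notation "x \oh y" := (hop x y) (at level 40, left associativity).

(* The operation on nonempty subsets, extended verbatim to all subsets. *)
Definition hmul (H : hypergroupoid) (A B : set H) : set H :=
  \bigcup_(p in A `*` B) (p.1 \oh p.2).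

Notation "A \*h B" := (hmul A B) (at level 40, left associativity).

Record hypersemigroup := Hypersemigroup {
  hbase :> hypergroupoid;
  hopA : forall x y z : hbase,
    (x \oh y) \*h [set z] = [set x] \*h (y \oh z)
}.

(* Iterated products, here and for fuzzy subsets, are bracketed to the left;
   both products are associative on a hypersemigroup. *)
Definition semisimple (H : hypersemigroup) : Prop :=
  forall a : H, exists x y z : H,
    ((x \oh a) \*h (y \oh a) \*h [set z]) a.

Definition fuzzy (R : realType) (H : Type) := H -> {i01 R}.

Section FuzzyProduct.
Context {R : realType} {H : hypergroupoid}.
Implicit Types f g : fuzzy R H.

Definition factorizations (a : H) : set (H * H) :=
  [set p | (p.1 \oh p.2) a].

Definition fuzzy_mul_val f g (a : H) : R :=
  if factorizations a != set0 then
    sup [set Num.min (f p.1)%:num (g p.2)%:num | p in factorizations a]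
  else 0.

Lemma fuzzy_mul_val_ge0 f g a : 0 <= fuzzy_mul_val f g a.
Proof.
rewrite /fuzzy_mul_val; case: ifPn => // /set0P[q Aq].
apply: (@le_trans _ _ (Num.min (f q.1)%:num (g q.2)%:num)).
  by rewrite le_min !ge0.
apply: ub_le_sup; last by exists q.
by exists 1 => _ [p _ <-]; rewrite ge_min le1.
Qed.

Lemma fuzzy_mul_val_le1 f g a : fuzzy_mul_val f g a <= 1.
Proof.
rewrite /fuzzy_mul_val; case: ifPn => // /set0P[q Aq].
apply: ge_sup; first by exists (Num.min (f q.1)%:num (g q.2)%:num), q.
by move=> _ [p _ <-]; rewrite ge_min le1.
Qed.

Definition fuzzy_mul f g : fuzzy R H :=
  fun a => Itv01 (fuzzy_mul_val_ge0 f g a) (fuzzy_mul_val_le1 f g a).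

Definition fuzzy_le f g : Prop := forall x : H, (f x)%:num <= (g x)%:num.

Definition fuzzy_one : fuzzy R H := fun=> 1%:i01.

End FuzzyProduct.

Notation "f \of g" := (fuzzy_mul f g) (at level 40, left associativity).

(* Main.v *)
Require Import Defs.
From mathcomp Require Import all_boot all_order all_algebra.
From mathcomp Require Import all_classical all_reals.

(** A fuzzy subset is determined by its strict level sets [{f > r}], and for
    [r >= 0] passing to the level set turns the product of fuzzy subsets into
    the product of subsets: a supremum exceeds [r] exactly when one of its
    members does ([level_fuzzy_mul]).  Hence the inequality
    [f <= 1 f 1 f 1], required for all [f], is the inclusion
    [A `<=` H A H A H] required for all subsets [A]: in one direction every [A]
    is a level set of its indicator, and in the other the inclusion is applied
    to all level sets of [f], which determine the order on fuzzy subsets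
    ([fuzzy_le_level]).  For singletons the inclusion is semisimplicity up to
    associativity, and it extends from singletons to all [A] because the
    product of subsets is monotone ([semisimple_subset]). *)

Set Implicit Arguments.
Unset Strict Implicit.
Unset Printing Implicit Defensive.

Import Order.TTheory GRing.Theory Num.Theory.
Local Open Scope classical_set_scope.
Local Open Scope ring_scope.

Lemma mem_hmul (H : hypergroupoid) (A B : set H) (a : H) :
  (A \*h B) a <-> exists b c, [/\ A b, B c & (b \oh c) a].
Proof.
split=> [[[b c] [/= Ab Bc] abc]|[b [c [Ab Bc abc]]]]; first by exists b, c.
by exists (b, c).
Qed.

(** The semisimplicity condition groups the factors as [(x a)(y a)z], whereas
    the product on the right is bracketed to the left; associativity is used
    once to move [y] from the second group to the first. *)
Lemma semisimple_subset (H : hypersemigroup) :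
  semisimple H <->
  forall A : set H, A `<=` setT \*h A \*h setT \*h A \*h setT.
Proof.
split=> [ssH A a Aa|subH a].
  have [x [y [z /mem_hmul[w [_ [+ -> awz]]]]]] := ssH a.
  move=> /mem_hmul[u [v [uxa vya wuv]]].
  have : ([set u] \*h (y \oh a)) w by apply/mem_hmul; exists u, v.
  rewrite -hopA => /mem_hmul[t [_ [tuy -> wta]]].
  apply/mem_hmul; exists w, z; split=> //.
  apply/mem_hmul; exists t, a; split=> //.
  apply/mem_hmul; exists u, y; split=> //.
  by apply/mem_hmul; exists x, a.
have /mem_hmul[w [z [+ _ awz]]] := subH [set a] a erefl.
move=> /mem_hmul[t [_ [+ -> wta]]] => /mem_hmul[u [y [+ _ tuy]]].
move=> /mem_hmul[x [_ [_ -> uxa]]].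
exists x, y, z; apply/mem_hmul; exists w, z; split=> //.
have : ((u \oh y) \*h [set a]) w by apply/mem_hmul; exists t, a.
rewrite hopA => /mem_hmul[_ [v [-> vya wuv]]].
by apply/mem_hmul; exists u, v.
Qed.

Definition level {R : realType} {H : Type} (r : R) (f : fuzzy R H) : set H :=
  [set x | r < (f x)%:num].

(** Strictness matters: the supremum need not be attained, so the analogous
    statement for [{f >= r}] fails.  The condition [0 <= r] accounts for the
    elements without factorization, where the product takes the value [0]. *)
Lemma level_fuzzy_mul (R : realType) (H : hypergroupoid) (r : R)
    (f g : fuzzy R H) : 0 <= r ->
  level r (f \of g) = level r f \*h level r g.
Proof.
move=> r0; apply/seteqP; split=> a; rewrite /level /= /fuzzy_mul_val.
  case: ifPn => [/set0P[q Aq]|_]; last by rewrite ltNge r0.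
  move=> /sup_gt[|_ [[b c] /= abc <-]].
    by exists (Num.min (f q.1)%:num (g q.2)%:num), q.
  by rewrite lt_min => /andP[rf rg]; apply/mem_hmul; exists b, c.
move=> /mem_hmul[b [c [rf rg abc]]].
rewrite ifT; last by apply/set0P; exists (b, c).
apply: (@lt_le_trans _ _ (Num.min (f b)%:num (g c)%:num)).
  by rewrite lt_min; apply/andP.
apply: ub_le_sup; last by exists (b, c).
by exists 1 => _ [p _ <-]; rewrite ge_min le1.
Qed.

Lemma level_fuzzy_one (R : realType) (H : hypergroupoid) (r : R) : r < 1 ->
  level r (@fuzzy_one R H) = setT.
Proof. by move=> r1; apply/seteqP; split. Qed.

Lemma fuzzy_le_level (R : realType) (H : hypergroupoid) (f g : fuzzy R H) :
  fuzzy_le f g <-> forall r, 0 <= r < 1 -> level r f `<=` level r g.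
Proof.
split=> [fg r _ x rf|sub x]; first exact: lt_le_trans rf (fg x).
(* At the level [r = g x] the point [x] is never in [level r g]. *)
rewrite leNgt; apply/negP => gf.
have /sub/(_ x gf) : 0 <= (g x)%:num < 1.
  by rewrite ge0 /=; apply: lt_le_trans gf (le1 _).
by rewrite /level /= ltxx.
Qed.

Definition fuzzy_indic (R : realType) (H : Type) (A : set H) : fuzzy R H :=
  fun x => if `[< A x >] then 1%:i01 else 0%:i01.

Lemma level0_fuzzy_indic (R : realType) (H : Type) (A : set H) :
  level 0 (@fuzzy_indic R H A) = A.
Proof.
apply/seteqP; split=> x; rewrite /level /fuzzy_indic /=;
  by case: asboolP => //=; rewrite ?ltxx ?ltr01.
Qed.

Theorem theorem13 (R : realType) (H : hypersemigroup) :
  semisimple H <->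
  (forall f : fuzzy R H,
     fuzzy_le f (fuzzy_one \of f \of fuzzy_one \of f \of fuzzy_one)).
Proof.
have levelE (r : R) (f : fuzzy R H) : 0 <= r < 1 ->
    level r (fuzzy_one \of f \of fuzzy_one \of f \of fuzzy_one) =
    setT \*h level r f \*h setT \*h level r f \*h setT.
  by move=> /andP[r0 r1]; rewrite !level_fuzzy_mul// level_fuzzy_one.
rewrite semisimple_subset; split=> [subH f|leH A].
  by apply/fuzzy_le_level => r r01; rewrite levelE.
have r01 : 0 <= (0 : R) < 1 by rewrite lexx ltr01.
have /fuzzy_le_level/(_ 0 r01) := leH (fuzzy_indic R A).
by rewrite levelE// level0_fuzzy_indic.
Qed.
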